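(* Let $A>0$ and let $\mathcal{P}=(\mathcal{P}_x)_{x\in\Sigma}$ be a channel of probability measures on $\mathbb{R}$. Suppose that $\mathcal{P}_0$ has mean $\mu$ and variance $\sigma^2>0$, and that, for all $x\in\Sigma$, $\mathcal{P}_x$ belongs to the natural exponential family generated by $\mathcal{P}_0$ and has $x=\mathbb{E}_{y\sim\mathcal{P}_x}[y]-\mu$. Suppose also that the cumulant generating function $\psi(\theta)=\log\mathbb{E}_{y\sim\mathcal{P}_0}\exp(\theta y)$ satisfies: 1. $\psi$ is $C^5$ in an open set $U$ containing zero; 2. $\psi'(U)$ contains an open set $U'\supset[-A+\mu,A+\mu]$. Then: (C1) the channel overlap $R_{\mathcal{P}}(x^{(1)},x^{(2)})$ is $C^4$ in an open set containing $[-A,A]^2$; (C2) $\frac{\partial^3R_{\mathcal{P}}}{\partial (x^{(1)})^2\,\partial x^{(2)}}(0,0)=0$; and the Fisher information is $$F_{\mathcal{P}}=\frac1{\sigma^2}.$$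
   Context: A channel $\mathcal{P}=(\mathcal{P}_x)_{x\in\Sigma}$ is a family of probability measures on a measurable space indexed by a set $\Sigma\subseteq\mathbb{R}$ containing $0$. Here $\Sigma$ contains $\{u-\mu:u\in U'\}$, an open set containing $[-A,A]$. Standing assumption under which the channel overlap is defined (''goodness''): for all $x\in\Sigma$, $\mathcal{P}_x$ is absolutely continuous with respect to $\mathcal{P}_0$ and $d\mathcal{P}_x/d\mathcal{P}_0\in L^2(\mathcal{P}_0)$. Channel overlap: $R_{\mathcal{P}}(x^{(1)},x^{(2)})=\mathbb{E}_{y\sim\mathcal{P}_0}\left[\left(\frac{d\mathcal{P}_{x^{(1)}}}{d\mathcal{P}_0}(y)-1\right)\left(\frac{d\mathcal{P}_{x^{(2)}}}{d\mathcal{P}_0}(y)-1\right)\right]$. Fisher information: $F_{\mathcal{P}}=\frac{\partial^2R_{\mathcal{P}}}{\partial x^{(1)}\partial x^{(2)}}(0,0)$. Natural exponential family generated by a probability measure $\mathcal{P}_0$ on $\mathbb{R}$ that is not a single atom: with $\psi(\theta)=\log\mathbb{E}_{y\sim\mathcal{P}_0}\exp(\theta y)$ and $\Theta=\{\theta\in\mathbb{R}:\psi(\theta)<\infty\}$, it is the family $\{\widetilde{\mathcal{P}}_\theta\}_{\theta\in\Theta}$ with $\frac{d\widetilde{\mathcal{P}}_\theta}{d\mathcal{P}_0}(y)=\exp(\theta y-\psi(\theta))$. *)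

(* Defs.v *)
From HB Require Import structures.
From mathcomp Require Import all_boot all_order all_algebra.
From mathcomp Require Import all_classical all_reals all_analysis.

Set Implicit Arguments.
Unset Strict Implicit.
Unset Printing Implicit Defensive.

Import Order.TTheory GRing.Theory Num.Theory.
Import numFieldNormedType.Exports.

Local Open Scope classical_set_scope.
Local Open Scope ring_scope.
Local Open Scope charge_scope.

Section smoothness.
Context {R : realType}.

(* Meant for an open set [U], on which continuity and derivability at a point
   do not depend on the values of the function outside [U]. *)
Fixpoint continuously_differentiable (k : nat) (U : set R) (f : R -> R) : Prop :=
  match k with
  | 0%N => forall x, U x -> {for x, continuous f}
  | k'.+1 => (forall x, U x -> derivable f x 1) /\
             continuously_differentiable k' U (derive1 f)
  end.

Definition partial1 (f : R -> R -> R) : R -> R -> R :=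
  fun x y => derive1 (f ^~ y) x.

Definition partial2 (f : R -> R -> R) : R -> R -> R :=
  fun x y => derive1 (f x) y.

(* All iterated partial derivatives of order at most [k], in any order of the
   variables, exist on [W] and those of order [k] are (jointly) continuous. *)
Fixpoint continuously_differentiable2 (k : nat) (W : set (R * R))
    (f : R -> R -> R) : Prop :=
  match k with
  | 0%N => forall p, W p -> {for p, continuous (fun q : R * R => f q.1 q.2)}
  | k'.+1 => [/\ forall p, W p -> derivable (f ^~ p.2) p.1 1,
                 forall p, W p -> derivable (f p.1) p.2 1,
                 continuously_differentiable2 k' W (partial1 f) &
                 continuously_differentiable2 k' W (partial2 f)]
  end.

End smoothness.

(* A channel indexed by [Sigma] is a family [P : R -> probability T R] of which
   only the members [P x] with [Sigma x] are constrained. *)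
Section channels.
Context d {T : measurableType d} {R : realType}.
Implicit Types (Sigma : set R) (P : R -> probability T R).

(* The library's Radon-Nikodym derivative of [Q] with respect to [P0] is finite
   everywhere when [Q `<< P0], so that [fine] loses nothing in that case. *)
Definition likelihood_ratio (Q P0 : probability T R) : T -> R :=
  fun y => fine ('d (charge_of_finite_measure Q) '/d P0 y).

Definition good_channel Sigma P : Prop :=
  forall x, Sigma x ->
    P x `<< P 0 /\ likelihood_ratio (P x) (P 0) \in Lfun (P 0) 2%:E.

Definition channel_overlap P (x1 x2 : R) : R :=
  fine (expectation (P 0) (fun y => (likelihood_ratio (P x1) (P 0) y - 1) *
                                    (likelihood_ratio (P x2) (P 0) y - 1))).

Definition fisher_information P : R :=
  partial1 (partial2 (channel_overlap P)) 0 0.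

End channels.

Section natural_exponential_family.
Context {R : realType}.
Local Notation prob := (probability (measurableTypeR R) R).

Definition cumulant (P0 : prob) (theta : R) : \bar R :=
  lne (mmt_gen_fun P0 idfun theta).

Definition nef_domain (P0 : prob) : set R := [set theta | (cumulant P0 theta < +oo)%E].

Definition in_nef (P0 Q : prob) : Prop :=
  exists2 theta, nef_domain P0 theta &
    Q `<< P0 /\
    {ae P0, forall y, likelihood_ratio Q P0 y =
                      expR (theta * y - fine (cumulant P0 theta))}.

End natural_exponential_family.

(* Main.v *)
Require Import Defs.
From HB Require Import structures.
From mathcomp Require Import all_boot all_order all_algebra.
From mathcomp Require Import all_classical all_reals all_analysis.
From mathcomp Require Import ring lra measurable_realfun.

Set Implicit Arguments.
Unset Strict Implicit.
Unset Printing Implicit Defensive.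

Import Order.TTheory GRing.Theory Num.Theory.
Import numFieldNormedType.Exports.

Local Open Scope classical_set_scope.
Local Open Scope ring_scope.

(** The channel is an exponential family in disguise, and in its natural
    parameter everything is explicit.  Let [M k theta] be the integral of
    [y ^+ k * expR (theta * y)] under [P 0].  If [P x] is the tilt of
    parameter [t x], then [P x] has density [expR (t x * y) / M 0 (t x)] and,
    expanding the product of two centered densities,
    [R(x, y) = M 0 (t x + t y) / (M 0 (t x) * M 0 (t y)) - 1]
    ([is_tilt_overlap]).

    The functions [M k] are smooth on the interior [J] of the domain of the
    cumulant: moments there are dominated by exponentials with slightly larger
    and slightly smaller parameter ([dominated_moments]), so one differentiates
    under the integral sign, and [M k] has derivative [M k.+1].  The tilted
    measure of parameter [theta] has mean [m = M 1 / M 0], whose derivative is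
    the variance of the tilted measure ([is_derive_tilted_mean]).  This variance
    is positive because [P 0] is not a point mass, so [m] is injective on the
    interval [J] by Rolle's theorem.

    Goodness says that the density of [P x] is square integrable, that is,
    [2 * t x] belongs to the domain; as [0] lies in [J], the midpoint [t x]
    does too.  Hence [m (t x) = x + mu] determines [t x], and [t] is a local
    inverse of [m - mu].  So it is differentiable with [t' = w \o t], where
    [w] is the inverse of the tilted variance, and smooth because [w] is.
    Nearby parameters are values of [t] as well, so [2 * t x], and by convexity
    [t x + t y], is interior to the domain.  Every function
    [M k (t x + t y) * (g x * h y)] with smooth [g] and [h] has partial
    derivatives that are sums of functions of this shape ([Ck2_sum_variable]),
    which gives the smoothness of the overlap.

    Finally [t 0 = 0] and [t'(0) = 1 / sigma ^+ 2], and differentiating in the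
    second variable at [0] gives
    [t'(0) * (m (t x) - mu) = t'(0) * x] ([partial2_param_overlap]).  This is
    linear in [x]: its derivative is the Fisher information [1 / sigma ^+ 2],
    and its second derivative vanishes. *)

(** * Calculus of continuously differentiable functions *)

Lemma open_near {T : topologicalType} (U : set T) (x : T) :
  open U -> U x -> \near x, U x.
Proof. by move=> oU Ux; exact: open_nbhs_nbhs. Qed.

Lemma open_setX {S T : topologicalType} (A : set S) (B : set T) :
  open A -> open B -> open (A `*` B).
Proof.
move=> oA oB; rewrite openE => -[x y] [/= Ax By].
exists (A, B); first by split; exact: open_nbhs_nbhs.
by move=> [a b] [].
Qed.

Section calculus.
Context {R : realType}.
Implicit Types (U : set R) (f g : R -> R) (x y l a b c : R).

Lemma is_derive1_derive1 f x : derivable f x 1 -> is_derive x 1 f (derive1 f x).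
Proof. by move=> df; apply: (DeriveDef df); rewrite derive1E. Qed.

Lemma derive1_is_derive1 f x l : is_derive x 1 f l -> derive1 f x = l.
Proof. by move=> df; rewrite derive1E derive_val. Qed.

Lemma continuous_derive1 f x l : is_derive x 1 f l -> {for x, continuous f}.
Proof.
by move=> df; exact/differentiable_continuous/derivable1_diffP/ex_derive.
Qed.

Lemma is_derive1M f g x a b : is_derive x 1 f a -> is_derive x 1 g b ->
  is_derive x 1 (fun z => f z * g z) (a * g x + f x * b).
Proof.
move=> df dg; apply: is_derive_eq (is_deriveM df dg) _.
by rewrite /GRing.scale /= addrC mulrC.
Qed.

Lemma Ck_ext n U f g : open U -> (forall x, U x -> f x = g x) ->
  continuously_differentiable n U f -> continuously_differentiable n U g.
Proof.
move=> oU; elim: n f g => [|n ih] f g fg /=.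
  move=> cf x Ux; have fgx : \near x, f x = g x.
    by apply: filterS (open_near oU Ux) => z; exact: fg.
  have := cf x Ux; rewrite /prop_for /continuous_at (fg x Ux) => cfx.
  by apply: cvg_trans cfx; apply: near_eq_cvg; apply: filterS fgx => z /esym.
have fgx x : U x -> \near x, f x = g x.
  by move=> Ux; apply: filterS (open_near oU Ux) => z; exact: fg.
move=> [df cf]; split=> [x Ux|].
  by apply: near_eq_derivable (df x Ux); exact: fgx.
apply: ih cf => x Ux; rewrite !derive1E; apply: near_eq_derive; exact: fgx.
Qed.

(** A convenient constructor: only the values of the derivative on [U] matter,
    so any function that agrees with [derive1 f] there may be supplied. *)
Lemma CkS n U f f' : open U -> (forall x, U x -> is_derive x 1 f (f' x)) ->
  continuously_differentiable n U f' -> continuously_differentiable n.+1 U f.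
Proof.
move=> oU df cf'; split=> [x /df dfx|]; first exact: ex_derive.
by apply: Ck_ext cf' => // x /df /derive1_is_derive1.
Qed.

Lemma Ck_pred n U f : continuously_differentiable n.+1 U f ->
  continuously_differentiable n U f.
Proof.
elim: n f => [|n ih] f [df cf].
  by move=> x /df /is_derive1_derive1 /continuous_derive1.
by split=> //; exact: ih.
Qed.

Lemma Ck_cst n U c : open U -> continuously_differentiable n U (fun=> c).
Proof.
move=> oU; elim: n c => [|n ih] c; first by move=> x _; exact: cst_continuous.
by refine (@CkS n U _ (fun=> 0) oU _ (ih 0)) => x _; exact: is_derive_cst.
Qed.

Lemma CkD n U f g : open U -> continuously_differentiable n U f ->
  continuously_differentiable n U g ->
  continuously_differentiable n U (fun x => f x + g x).
Proof.
move=> oU; elim: n f g => [|n ih] f g.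
  by move=> cf cg x Ux; apply: cvgD; [exact: cf|exact: cg].
move=> [df cf] [dg cg]; apply: (CkS oU _ (ih _ _ cf cg)) => x Ux.
by apply: is_deriveD; apply: is_derive1_derive1; [exact: df|exact: dg].
Qed.

Lemma CkM n U f g : open U -> continuously_differentiable n U f ->
  continuously_differentiable n U g ->
  continuously_differentiable n U (fun x => f x * g x).
Proof.
move=> oU; elim: n f g => [|n ih] f g.
  by move=> cf cg x Ux; apply: cvgM; [exact: cf|exact: cg].
move=> Cf Cg; have [df cf] := Cf; have [dg cg] := Cg.
refine (@CkS n U _ (fun x => derive1 f x * g x + f x * derive1 g x) oU _ _).
- move=> x Ux.
  by apply: is_derive1M; apply: is_derive1_derive1; [exact: df|exact: dg].
- by apply: CkD => //; apply: ih => //; exact: Ck_pred.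
Qed.

Lemma CkV n U f : open U -> (forall x, U x -> f x != 0) ->
  continuously_differentiable n U f ->
  continuously_differentiable n U (fun x => (f x)^-1).
Proof.
move=> oU f0; elim: n f f0 => [|n ih] f f0.
  by move=> cf x Ux; apply: cvgV; [exact: f0|exact: cf].
move=> Cf; have [df cf] := Cf.
pose f' x := -1 * ((f x)^-1 * (f x)^-1 * derive1 f x).
refine (@CkS n U _ f' oU _ _).
- move=> x Ux; apply: is_derive_eq.
    by apply: is_deriveV; [exact: f0|exact/is_derive1_derive1/df].
  by rewrite /f' /GRing.scale /= -expr2 exprVn mulN1r mulNr.
- have Vn := ih _ f0 (Ck_pred Cf).
  apply: CkM => //; first exact: Ck_cst.
  by apply: CkM => //; exact: CkM.
Qed.

(** Smoothness of a solution of the autonomous equation [t' = w \o t], in the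
    form needed for inverse functions: since [(F \o t)' = (F' * w) \o t], the
    induction on [n] runs over all [F] at once and never differentiates [t]
    twice. *)
Lemma Ck_comp_inverse n D V t w F : open D -> open V ->
  (forall x, D x -> V (t x)) ->
  (forall x, D x -> is_derive x 1 t (w (t x))) ->
  (forall k, continuously_differentiable k V w) ->
  continuously_differentiable n V F ->
  continuously_differentiable n D (F \o t).
Proof.
move=> oD oV DV dt cw; elim: n F => [|n ih] F.
  move=> cF x Dx; apply: continuous_comp; last exact/cF/DV.
  exact: (continuous_derive1 (dt x Dx)).
move=> [dF cF].
refine (@CkS n D _ ((fun z => derive1 F z * w z) \o t) oD _ _).
- move=> x Dx; apply: is_derive1_comp; last exact: dt.
  exact/is_derive1_derive1/dF/DV.
- by apply: ih; apply: CkM.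
Qed.

Implicit Types (W : set (R * R)) (F G : R -> R -> R).

Lemma open_near_fst W p : open W -> W p -> \forall x \near p.1, W (x, p.2).
Proof.
move=> oW Wp; have /= c : {for p.1, continuous (fun x : R => (x, p.2))}.
  exact: (cvg_pair (cvg_id : (fun x : R => x) x @[x --> p.1] --> p.1)
                   (cvg_cst p.2)).
have /c : nbhs (p.1, p.2) W.
  by apply: open_nbhs_nbhs; split=> //; case: p Wp {c}.
exact: id.
Qed.

Lemma open_near_snd W p : open W -> W p -> \forall x \near p.2, W (p.1, x).
Proof.
move=> oW Wp; have /= c : {for p.2, continuous (fun x : R => (p.1, x))}.
  exact: (cvg_pair (cvg_cst p.1)
                   (cvg_id : (fun x : R => x) x @[x --> p.2] --> p.2)).
have /c : nbhs (p.1, p.2) W.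
  by apply: open_nbhs_nbhs; split=> //; case: p Wp {c}.
exact: id.
Qed.

Lemma Ck2_ext n W F G : open W ->
  (forall p, W p -> F p.1 p.2 = G p.1 p.2) ->
  continuously_differentiable2 n W F -> continuously_differentiable2 n W G.
Proof.
move=> oW; elim: n F G => [|n ih] f g fg /=.
  move=> cf p Wp; have fgp : \near p, f p.1 p.2 = g p.1 p.2.
    by near=> q; apply: fg; near: q; exact: open_nbhs_nbhs.
  have := cf p Wp; rewrite /prop_for /continuous_at (fg p Wp) => cfp.
  by apply: cvg_trans cfp; apply: near_eq_cvg; apply: filterS fgp => z /esym.
have fg1 p : W p -> \forall x \near p.1, f x p.2 = g x p.2.
  by move=> Wp; apply: filterS (open_near_fst oW Wp) => z /fg.
have fg2 p : W p -> \forall x \near p.2, f p.1 x = g p.1 x.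
  by move=> Wp; apply: filterS (open_near_snd oW Wp) => z /fg.
move=> [df1 df2 cf1 cf2]; split.
- by move=> p Wp; apply: near_eq_derivable (df1 p Wp); exact: fg1.
- by move=> p Wp; apply: near_eq_derivable (df2 p Wp); exact: fg2.
- apply: ih cf1 => p Wp; rewrite /partial1 !derive1E; apply: near_eq_derive.
  exact: fg1.
- apply: ih cf2 => p Wp; rewrite /partial2 !derive1E; apply: near_eq_derive.
  exact: fg2.
Unshelve. all: by end_near. Qed.

Lemma Ck2S n W F F1 F2 : open W ->
  (forall p, W p -> is_derive p.1 1 (F ^~ p.2) (F1 p.1 p.2)) ->
  (forall p, W p -> is_derive p.2 1 (F p.1) (F2 p.1 p.2)) ->
  continuously_differentiable2 n W F1 ->
  continuously_differentiable2 n W F2 ->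
  continuously_differentiable2 n.+1 W F.
Proof.
move=> oW d1 d2 c1 c2; split.
- by move=> p /d1 dp; exact: ex_derive.
- by move=> p /d2 dp; exact: ex_derive.
- by apply: Ck2_ext c1 => // p /d1 /derive1_is_derive1.
- by apply: Ck2_ext c2 => // p /d2 /derive1_is_derive1.
Qed.

Lemma Ck2D n W F G : open W -> continuously_differentiable2 n W F ->
  continuously_differentiable2 n W G ->
  continuously_differentiable2 n W (fun x y => F x y + G x y).
Proof.
move=> oW; elim: n F G => [|n ih] f g.
  move=> cf cg p Wp; apply: (@cvgD _ _ _ _ _ (fun q : R * R => f q.1 q.2)).
    exact: cf.
  exact: cg.
move=> [df1 df2 cf1 cf2] [dg1 dg2 cg1 cg2].
apply: (Ck2S oW _ _ (ih _ _ cf1 cg1) (ih _ _ cf2 cg2)) => p Wp.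
  by apply: is_deriveD; apply: is_derive1_derive1; [exact: df1|exact: dg1].
by apply: is_deriveD; apply: is_derive1_derive1; [exact: df2|exact: dg2].
Qed.

Lemma Ck2_cst n W c : open W -> continuously_differentiable2 n W (fun _ _ => c).
Proof.
move=> oW; elim: n c => [|n ih] c; first by move=> x _; exact: cst_continuous.
pose z (_ _ : R) : R := 0.
by refine (@Ck2S n W _ z z oW _ _ (ih 0) (ih 0)) => x _;
  exact: is_derive_cst.
Qed.

(** The family of functions [K k (t x + t y) * (g x * h y)] is closed, up to
    sums, under both partial derivatives, provided that [K k.+1] is the
    derivative of [K k]: the induction therefore quantifies over [k], [g]
    and [h]. *)
Lemma Ck2_sum_variable n k (K : nat -> R -> R) (J D : set R) t t' g h :
  open D -> 
  (forall x y, D x -> D y -> J (t x + t y)) ->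
  (forall k u, J u -> is_derive u 1 (K k) (K k.+1 u)) ->
  (forall x, D x -> is_derive x 1 t (t' x)) ->
  (forall k, continuously_differentiable k D t') ->
  (forall k, continuously_differentiable k D g) ->
  (forall k, continuously_differentiable k D h) ->
  continuously_differentiable2 n (D `*` D)
    (fun x y => K k (t x + t y) * (g x * h y)).
Proof.
move=> oD DJ dK dt ct'; elim: n k g h => [|n ih] k g h cg ch.
  move=> [x y] [/= Dx Dy].
  apply: (@cvgM _ _ _ _ (fun q : R * R => K k (t q.1 + t q.2))).
    apply: (@continuous_comp _ _ _ (fun q : R * R => t q.1 + t q.2) (K k));
      last exact: continuous_derive1 (dK k _ (DJ _ _ Dx Dy)).
    apply: (@cvgD _ _ _ _ _ (fun q : R * R => t q.1)).
      apply: (@continuous_comp _ _ _ (fun q : R * R => q.1) t).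
        exact: cvg_fst.
      exact: continuous_derive1 (dt _ Dx).
    apply: (@continuous_comp _ _ _ (fun q : R * R => q.2) t).
      exact: cvg_snd.
    exact: continuous_derive1 (dt _ Dy).
  apply: (@cvgM _ _ _ _ (fun q : R * R => g q.1)).
    apply: (@continuous_comp _ _ _ (fun q : R * R => q.1) g).
      exact: cvg_fst.
    exact: (cg 0).
  apply: (@continuous_comp _ _ _ (fun q : R * R => q.2) h).
    exact: cvg_snd.
  exact: (ch 0).
have oDD : open (D `*` D) by exact: open_setX.
have cdg' : forall k, continuously_differentiable k D (derive1 g).
  by move=> j; have [] := cg j.+1.
have cdh' : forall k, continuously_differentiable k D (derive1 h).
  by move=> j; have [] := ch j.+1.
have cgt : forall k, continuously_differentiable k D (fun x => t' x * g x).
  by move=> j; exact: CkM.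
have cht : forall k, continuously_differentiable k D (fun x => t' x * h x).
  by move=> j; exact: CkM.
pose f1 x y := K k.+1 (t x + t y) * ((t' x * g x) * h y) +
               K k (t x + t y) * (derive1 g x * h y).
pose F x y := K k.+1 (t x + t y) * (g x * (t' y * h y)) +
               K k (t x + t y) * (g x * derive1 h y).
apply: (@Ck2S _ _ _ f1 F oDD).
- move=> [x y] [/= Dx Dy].
  have dKt : is_derive x 1 (K k \o (fun x => t x + t y))
     (K k.+1 (t x + t y) * t' x).
    apply: is_derive1_comp; first exact/dK/DJ.
    apply: is_derive_eq.
      exact: is_deriveD (dt _ Dx) (is_derive_cst (t y) x 1).
    by rewrite addr0.
  have dgh : is_derive x 1 (fun x => g x * h y) (derive1 g x * h y + g x * 0).
    exact: is_derive1M (is_derive1_derive1 ((cg 1%N).1 _ Dx))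
                       (is_derive_cst (h y) x 1).
  apply: is_derive_eq (is_derive1M dKt dgh) _.
  by rewrite /f1 mulr0 addr0 !mulrA.
- move=> [x y] [/= Dx Dy].
  have dKt : is_derive y 1 (K k \o (fun y => t x + t y))
     (K k.+1 (t x + t y) * t' y).
    apply: is_derive1_comp; first exact/dK/DJ.
    apply: is_derive_eq.
      exact: is_deriveD (is_derive_cst (t x) y 1) (dt _ Dy).
    by rewrite add0r.
  have dgh : is_derive y 1 (fun y => g x * h y) (0 * h y + g x * derive1 h y).
    exact: is_derive1M (is_derive_cst (g x) y 1)
                       (is_derive1_derive1 ((ch 1%N).1 _ Dy)).
  apply: is_derive_eq (is_derive1M dKt dgh) _.
  rewrite /F mul0r add0r -!mulrA; congr (_ * _ + _).
  by rewrite mulrCA.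
- by apply: Ck2D => //; exact: ih.
- by apply: Ck2D => //; exact: ih.
Qed.

End calculus.

(** * Exponential moments *)

Section exponential_moments.
Context {R : realType} (P0 : probability (measurableTypeR R) R).
Implicit Types (k : nat) (theta s : R).

Definition exp_moment k theta : R := \int[P0]_y (y ^+ k * expR (theta * y)).

Lemma measurable_expR_scale theta :
  measurable_fun [set: measurableTypeR R] (fun y : R => expR (theta * y)).
Proof.
apply: measurableT_comp; first exact: measurable_realfun.measurable_expR.
exact: measurable_funM.
Qed.

Lemma measurable_moment k theta :
  measurable_fun [set: measurableTypeR R]
    (fun y : R => y ^+ k * expR (theta * y)).
Proof.
apply: measurable_funM; last exact: measurable_expR_scale.
exact: measurable_realfun.exprn_measurable.
Qed.

Lemma mgfE theta :
  mmt_gen_fun P0 idfun theta = (\int[P0]_y (expR (theta * y))%:E)%E.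
Proof.
rewrite /mmt_gen_fun unlock; apply: eq_integral => y _ /=.
by rewrite mulrC.
Qed.

(** The logarithm [lne] takes the value [+oo] only at [+oo]. *)
Lemma nef_domainP theta : nef_domain P0 theta <->
  P0.-integrable setT (EFin \o (fun y : R => expR (theta * y))).
Proof.
have mf := measurable_expR_scale theta.
have -> : nef_domain P0 theta <-> (mmt_gen_fun P0 idfun theta < +oo)%E.
  rewrite /nef_domain /cumulant /=.
  by case: (mmt_gen_fun _ _ _) => [r| |] //=; split; rewrite ?ltry ?ltNyr //;
    case: ifP; rewrite ?ltry ?ltNyr.
rewrite mgfE; split=> [fi|/integrableP[_]]; last first.
  by under eq_integral do rewrite /= ger0_norm ?expR_ge0//.
apply/integrableP; split; first exact/measurable_EFinP.
by under eq_integral do rewrite /= ger0_norm ?expR_ge0//.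
Qed.

Lemma expR_le_addR (a b c y : R) : a <= c -> c <= b ->
  expR (c * y) <= expR (a * y) + expR (b * y).
Proof.
move=> ac cb; case: (leP 0 y) => y0.
  apply: (@le_trans _ _ (expR (b * y))); last by rewrite lerDr expR_ge0.
  by rewrite ler_expR ler_wpM2r.
apply: (@le_trans _ _ (expR (a * y))); last by rewrite lerDl expR_ge0.
by rewrite ler_expR ler_wnM2r// ltW.
Qed.

Lemma nef_domain_between (a b c : R) : a <= c -> c <= b ->
  nef_domain P0 a -> nef_domain P0 b -> nef_domain P0 c.
Proof.
move=> ac cb /nef_domainP ia /nef_domainP ib; apply/nef_domainP.
have := integrableD measurableT ia ib; apply: le_integrable => //.
  by apply/measurable_EFinP; exact: measurable_expR_scale.
move=> y _; rewrite /= lee_fin !ger0_norm ?addr_ge0 ?expR_ge0//.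
exact: expR_le_addR.
Qed.

(** If balls around [a] and [b] lie in the domain, then so does a ball around
    [c], each of whose points is between translates of [a] and [b]. *)
Lemma interior_nef_domain_between (a b c : R) : a <= c -> c <= b ->
  (nef_domain P0)° a -> (nef_domain P0)° b -> (nef_domain P0)° c.
Proof.
move=> ac cb /nbhs_ballP[e e0 ea] /nbhs_ballP[d d0 db].
apply/nbhs_ballP; exists (Num.min e d); first by rewrite /= lt_min e0.
move=> z; rewrite /ball /= lt_min => /andP[ze zd].
apply: (@nef_domain_between (z - c + a) (z - c + b)).
- lra.
- lra.
- by apply: ea; rewrite /ball /= (_ : a - _ = c - z); last lra.
- by apply: db; rewrite /ball /= (_ : b - _ = c - z); last lra.
Qed.

Lemma exprn_le_expR k (x : R) : 0 <= x -> x ^+ k <= k`!%:R * expR x.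
Proof.
move=> x0; case: k => [|k]; first by rewrite expr0 fact0 mul1r -expR0 ler_expR.
rewrite mulrC -ler_pdivrMr ?ltr0n ?fact_gt0//.
by apply: le_trans (expR_ge1Dxn k x0); rewrite lerDr.
Qed.

(** The factor [y ^+ k] costs at most [C * expR (e * `|y|)], moving the
    parameter by less than [e] costs another [expR (e * `|y|)], and
    [expR (theta * y + 2 * e * `|y|)] is at most the sum of the exponentials of
    parameters [theta - 2 * e] and [theta + 2 * e].  The radius [e] is the same
    for all [k], so that a moment and its derivative are dominated on the same
    interval. *)
Lemma dominated_moments theta : (nef_domain P0)° theta ->
  exists2 e, 0 < e & forall k, exists G : R -> R,
  [/\ forall y, 0 <= G y, P0.-integrable setT (EFin \o G) &
  forall s y, `|s - theta| < e -> `|y ^+ k * expR (s * y)| <= G y].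
Proof.
move=> /nbhs_ballP[d /= d0 dJ].
pose e := d / 4; have e0 : 0 < e by rewrite divr_gt0.
have e2d : 2 * e < d by rewrite /e; lra.
have Jl : nef_domain P0 (theta - 2 * e).
  by apply: dJ; rewrite /ball /= opprB addrCA subrr addr0 ger0_norm //; lra.
have Jr : nef_domain P0 (theta + 2 * e).
  apply: dJ; rewrite /ball /= opprD addrA subrr add0r normrN.
  by rewrite ger0_norm //; lra.
exists e => // k; pose C : R := k`!%:R / e ^+ k.
have C0 : 0 <= C by rewrite divr_ge0 ?exprn_ge0 ?ler0n// ltW.
exists (fun y => C * (expR ((theta - 2 * e) * y) + expR ((theta + 2 * e) * y))).
split=> [y||s y se].
- by rewrite mulr_ge0// addr_ge0// expR_ge0.
- move: Jl Jr => /nef_domainP il /nef_domainP ir.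
  exact: (integrableZl measurableT C (integrableD measurableT il ir)).
rewrite normrM normrX (ger0_norm (expR_ge0 _)).
have yk : `|y| ^+ k <= C * expR (e * `|y|).
  rewrite /C -mulrA mulrCA ler_pdivlMl ?exprn_gt0// -exprMn.
  by rewrite exprn_le_expR// mulr_ge0// ltW.
apply: (@le_trans _ _ (C * expR (e * `|y|) * expR (s * y))).
  by rewrite ler_wpM2r// expR_ge0.
rewrite -mulrA ler_wpM2l// -expRD.
have sy : s * y <= theta * y + e * `|y|.
  rewrite -lerBlDl -mulrBl (le_trans (ler_norm _))// normrM.
  by rewrite ler_wpM2r// ltW.
apply: (@le_trans _ _ (expR (theta * y + 2 * e * `|y|))).
  rewrite ler_expR; lra.
case: (leP 0 y) => y0.
  by rewrite (ger0_norm y0) -mulrDl lerDr expR_ge0.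
by rewrite (ltr0_norm y0) mulrN -mulNr -mulrDl lerDl expR_ge0.
Qed.

Lemma integrable_moment k theta : (nef_domain P0)° theta ->
  P0.-integrable setT (EFin \o (fun y : R => y ^+ k * expR (theta * y))).
Proof.
move=> /dominated_moments[e e0 /(_ k)[G [G0 iG Gb]]].
apply: le_integrable iG => //.
  by apply/measurable_EFinP; exact: measurable_moment.
move=> y _; rewrite /= lee_fin (ger0_norm (G0 _)); apply: Gb.
by rewrite subrr normr0.
Qed.

Lemma is_derive_exp_moment k theta : (nef_domain P0)° theta ->
  is_derive theta 1 (exp_moment k) (exp_moment k.+1 theta).
Proof.
move=> /dominated_moments[e e0 eG].
pose f s (y : measurableTypeR R) : R := y ^+ k * expR (s * y).
have df s (y : R) : is_derive s 1 (f ^~ y) (y ^+ k.+1 * expR (s * y)).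
  have dl : is_derive s 1 (fun s => s * y) y.
    have dl := is_derive1M (is_derive_id s 1) (is_derive_cst y s 1).
    by apply: is_derive_eq dl _; rewrite mulr0 addr0 mul1r.
  have de := @is_derive1_comp _ expR (fun s => s * y) s _ _
    (is_derive_expR _) dl.
  apply: is_derive_eq (is_derive1M (is_derive_cst (y ^+ k) s 1) de) _.
  by rewrite mul0r add0r exprS mulrA mulrC mulrA.
have fE s y : partial1of2 f s y = y ^+ k.+1 * expR (s * y).
  by rewrite /partial1of2 (derive1_is_derive1 (df s y)).
have It : `]theta - e, theta + e[%classic theta.
  by rewrite /= in_itv /= ltrBlDr ltrDl e0.
have Is s : `]theta - e, theta + e[%classic s -> `|s - theta| < e.
  by rewrite /= in_itv/= ltr_distl.
have intf s : `]theta - e, theta + e[%classic s ->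
    P0.-integrable setT (EFin \o f s).
  move=> /Is se; have [G [G0 iG Gb]] := eG k.
  apply: le_integrable iG => //.
    by apply/measurable_EFinP; exact: (measurable_moment k s).
  by move=> y _; rewrite /= lee_fin (ger0_norm (G0 _)); exact: Gb.
have [G [G0 iG Gb]] := eG k.+1.
have derf s (y : measurableTypeR R) : `]theta - e, theta + e[%classic s ->
  setT y ->
  derivable (f ^~ y) s 1 by move=> _ _; have dfs := df s y; exact: ex_derive.
have bG s (y : measurableTypeR R) : `]theta - e, theta + e[%classic s ->
  setT y ->
  `|partial1of2 f s y| <= G y.
  by move=> /Is se _; rewrite fE; exact: Gb.
apply: DeriveDef.
  exact: (derivable_under_integral measurableT It intf derf G0 iG bG).
rewrite -derive1E.
rewrite [LHS](differentiation_under_integral measurableT It intf derf G0 iG bG).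
by apply: eq_Rintegral => y _; rewrite fE.
Qed.

End exponential_moments.

(** * The mean function of an exponential family *)

Section tilted_mean.
Context {R : realType} (P0 : probability (measurableTypeR R) R).
Implicit Types (theta c : R).

Local Notation M := (exp_moment P0).
Local Notation J := (nef_domain P0)°.

Lemma Rintegral_eq0_ae (f : R -> R) : (forall y, 0 <= f y) ->
  P0.-integrable setT (EFin \o f) -> \int[P0]_y f y = 0 ->
  {ae P0, forall y : measurableTypeR R, f y = 0}.
Proof.
move=> f0 fi fI0; have mf := measurable_int _ fi.
have /(ae_eq_integral_abs P0 measurableT mf) :
    (\int[P0]_y `|(EFin \o f) y|)%E = 0%E.
  under eq_integral do rewrite gee0_abs ?lee_fin ?f0//.
  move: fI0; rewrite /Rintegral => fI0.
  by rewrite -[LHS]fineK ?fI0//; exact: integrable_fin_num.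
by apply: filterS => y /(_ I) [].
Qed.

Lemma ae_not_False : ~ {ae P0, forall y : measurableTypeR R, False}.
Proof.
move=> [N [mN N0]] NT.
have NE : N = setT by apply/seteqP; split => // y _; apply: NT => /=; case.
by move: N0; rewrite NE [LHS]probability_setT => /eqP; rewrite onee_eq0.
Qed.

Lemma exp_moment0E theta :
  M 0 theta = \int[P0]_y expR (theta * y).
Proof. by apply: eq_Rintegral => y _; rewrite expr0 mul1r. Qed.

Lemma exp_moment0_at0 : M 0 0 = 1.
Proof.
rewrite exp_moment0E; transitivity (\int[P0]_y (cst 1 y : R)).
  by apply: eq_Rintegral => y _; rewrite mul0r expR0.
rewrite (Rintegral_cst P0 measurableT) mul1r.
exact: (congr1 fine (probability_setT P0)).
Qed.

Lemma exp_moment0_gt0 theta : nef_domain P0 theta -> 0 < M 0 theta.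
Proof.
move=> /nef_domainP ti; rewrite exp_moment0E lt_def Rintegral_ge0; last first.
  by move=> y _; exact: expR_ge0.
rewrite andbT; apply/eqP => I0; apply: ae_not_False.
apply: filterS (Rintegral_eq0_ae _ ti I0) => y; last exact: expR_ge0.
by have := expR_gt0 (theta * y) => /[swap] ->; rewrite ltxx.
Qed.

Lemma centered_moment2E theta c : J theta ->
  M 2 theta - 2 * c * M 1 theta + c ^+ 2 * M 0 theta =
  \int[P0]_y ((y - c) ^+ 2 * expR (theta * y)).
Proof.
move=> Jt; have i0 := integrable_moment 0 Jt; have i1 := integrable_moment 1 Jt.
have i2 := integrable_moment 2 Jt.
have j1 := integrableZl measurableT (2 * c) i1.
have j0 := integrableZl measurableT (c ^+ 2) i0.
rewrite /exp_moment -(RintegralZl (2 * c) measurableT i1).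
rewrite -(RintegralZl (c ^+ 2) measurableT i0) -(RintegralB measurableT i2 j1).
rewrite -(RintegralD measurableT (integrableB measurableT i2 j1) j0).
by apply: eq_Rintegral => y _; rewrite expr1 expr0; lra.
Qed.

Hypothesis nondegenerate :
  forall c, ~ {ae P0, forall y : measurableTypeR R, y = c}.

(** Up to the factor [M 0 theta], the second moment of the tilted measure
    around [c]; it could vanish only for a point mass at [c]. *)
Lemma centered_moment2_gt0 theta c : J theta ->
  0 < M 2 theta - 2 * c * M 1 theta + c ^+ 2 * M 0 theta.
Proof.
move=> Jt; rewrite centered_moment2E//.
pose f (y : R) := (y - c) ^+ 2 * expR (theta * y).
have f0 y : 0 <= f y by rewrite mulr_ge0 ?sqr_ge0 ?expR_ge0.
have fi : P0.-integrable setT (EFin \o f).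
  have i0 := integrable_moment 0 Jt; have i1 := integrable_moment 1 Jt.
  have i2 := integrable_moment 2 Jt.
  have := integrableD measurableT
    (integrableB measurableT i2 (integrableZl measurableT (2 * c) i1))
    (integrableZl measurableT (c ^+ 2) i0).
  apply: eq_integrable => // y _.
  by rewrite /f /= expr1 expr0; congr EFin; lra.
rewrite lt_def Rintegral_ge0 ?andbT; last by move=> y _; exact: f0.
apply/eqP => If0; apply: (@nondegenerate c).
apply: filterS (Rintegral_eq0_ae f0 fi If0) => y /eqP.
by rewrite mulf_eq0 (gt_eqF (expR_gt0 _)) orbF sqrf_eq0 subr_eq0 => /eqP.
Qed.

Definition tilted_mean theta := M 1 theta / M 0 theta.

(** The quotient-rule derivative of [tilted_mean], which is the variance
    [M 2 / M 0 - (M 1 / M 0) ^+ 2] of the tilted measure. *)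
Definition tilted_variance theta :=
  (M 2 theta * M 0 theta - M 1 theta * M 1 theta) * (M 0 theta * M 0 theta)^-1.

Lemma interior_nef_domain theta : J theta -> nef_domain P0 theta.
Proof. exact: nbhs_singleton. Qed.

Lemma exp_moment0_neq0 theta : J theta -> M 0 theta != 0.
Proof.
by move=> /interior_nef_domain/exp_moment0_gt0; rewrite lt0r => /andP[].
Qed.

Lemma is_derive_tilted_mean theta : J theta ->
  is_derive theta 1 tilted_mean (tilted_variance theta).
Proof.
move=> Jt; have M0 := exp_moment0_neq0 Jt.
have := is_derive1M (is_derive_exp_moment 1 Jt)
  (is_deriveV M0 (is_derive_exp_moment 0 Jt)).
move=> dm; apply: is_derive_eq dm _.
have quotient (a b c : R) : a != 0 ->
    c / a + b * (- a ^- 2 * b) = (c * a - b * b) / (a * a).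
  by move=> a0; field.
exact: quotient.
Qed.

Lemma tilted_variance_gt0 theta : J theta -> 0 < tilted_variance theta.
Proof.
move=> Jt; have M0 := exp_moment0_neq0 Jt.
have M0_gt0 := exp_moment0_gt0 (interior_nef_domain Jt).
have centered (a b c : R) : a != 0 ->
    c - 2 * (b / a) * b + (b / a) ^+ 2 * a = (c * a - b * b) / (a * a) * a.
  by move=> a0; field.
have := centered_moment2_gt0 (tilted_mean theta) Jt.
by rewrite /tilted_mean centered// pmulr_lgt0.
Qed.

(** By Rolle's theorem, since [J] is an interval on which the derivative of the
    mean is a positive variance. *)
Lemma tilted_mean_inj theta theta' : J theta -> J theta' ->
  tilted_mean theta = tilted_mean theta' -> theta = theta'.
Proof.
wlog tt : theta theta' / theta < theta' => [wl Jt Jt' E|Jt Jt' E].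
  case: (ltgtP theta theta') => [h|h|//]; first exact: (wl _ _ h Jt Jt' E).
  exact: (esym (wl _ _ h Jt' Jt (esym E))).
have Jb c : c \in `[theta, theta'] -> J c.
  rewrite in_itv/= => /andP[ac cb].
  exact: interior_nef_domain_between ac cb _ _.
have dm c : c \in `[theta, theta'] -> derivable tilted_mean c 1.
  by move=> /Jb /is_derive_tilted_mean ?; exact: ex_derive.
have [||c cI dc0] := Rolle tt _ _ E.
- by move=> c /subset_itv_oo_cc /dm.
- by apply: derivable_within_continuous => c; exact: dm.
have Jc := Jb _ (subset_itv_oo_cc cI).
have := tilted_variance_gt0 Jc.
have /derive1_is_derive1 <- := is_derive_tilted_mean Jc.
by rewrite (derive1_is_derive1 dc0) ltxx.
Qed.

Lemma cumulantE theta : nef_domain P0 theta ->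
  fine (cumulant P0 theta) = ln (M 0 theta).
Proof.
move=> dt; have /nef_domainP ti := dt.
rewrite /cumulant mgfE.
have -> : (\int[P0]_y (expR (theta * y))%:E = (M 0 theta)%:E)%E.
  by rewrite exp_moment0E /Rintegral fineK//; exact: integrable_fin_num.
by rewrite lne_EFin ?exp_moment0_gt0.
Qed.

End tilted_mean.

(** * Likelihood ratios, means and overlaps of the tilted measures *)

Section exponential_family.
Context {R : realType} (P0 : probability (measurableTypeR R) R).
Implicit Types (theta c : R) (Q : probability (measurableTypeR R) R).

Local Notation M := (exp_moment P0).
Local Notation J := (nef_domain P0)°.

(** Every [s] is the midpoint of [2 * theta] and [2 * (s - theta)], and the
    latter is close to [0] when [s] is close to [theta]. *)
Lemma interior_nef_domain_half theta :
  J 0 -> nef_domain P0 (2 * theta) -> J theta.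
Proof.
move=> /nbhs_ballP[e /= e0 eJ] d2.
apply/nbhs_ballP; exists (e / 2) => /=; first by rewrite divr_gt0.
move=> s /=; rewrite /ball /= => se.
have d0 : nef_domain P0 (2 * (s - theta)).
  apply: eJ; rewrite /ball /= sub0r normrN normrM ger0_norm// distrC; lra.
case: (leP (2 * theta) (2 * (s - theta))) => h.
  by apply: (nef_domain_between _ _ d2 d0); lra.
by apply: (nef_domain_between _ _ d0 d2); lra.
Qed.

Lemma measurable_Radon_Nikodym Q : Q `<< P0 ->
  measurable_fun [set: measurableTypeR R]
    (Radon_Nikodym (charge_of_finite_measure Q) P0).
Proof.
move=> QP; apply: measurable_int.
exact: (@Radon_Nikodym_integrable _ _ _ (charge_of_finite_measure Q) P0 QP).
Qed.

Lemma measurable_likelihood_ratio Q : Q `<< P0 ->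
  measurable_fun [set: measurableTypeR R] (likelihood_ratio Q P0).
Proof.
move=> QP; apply: (measurableT_comp (fine_measurable measurableT)).
exact: measurable_Radon_Nikodym.
Qed.

Definition tilt_density theta (y : R) : R := expR (theta * y) * (M 0 theta)^-1.

Definition is_tilt theta Q := [/\ nef_domain P0 theta, Q `<< P0 &
  {ae P0, forall y : measurableTypeR R,
    likelihood_ratio Q P0 y = tilt_density theta y}].

Lemma in_nef_is_tilt Q : in_nef P0 Q -> exists theta, is_tilt theta Q.
Proof.
move=> [theta dt [QP Qt]]; exists theta; split => //.
apply: filterS Qt => y ->; rewrite cumulantE// /tilt_density expRB lnK//.
by rewrite posrE exp_moment0_gt0.
Qed.

Lemma measurable_tilt_density theta :
  measurable_fun [set: measurableTypeR R] (tilt_density theta).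
Proof.
by apply: measurable_funM => //; exact: measurable_expR_scale.
Qed.

Lemma tilt_density_ge0 theta y :
  nef_domain P0 theta -> 0 <= tilt_density theta y.
Proof.
by move=> /exp_moment0_gt0 ?; rewrite mulr_ge0 ?expR_ge0// invr_ge0 ltW.
Qed.

(** The square of [expR (theta * y)] is [expR (2 * theta * y)]. *)
Lemma is_tilt_L2 theta Q : is_tilt theta Q ->
  likelihood_ratio Q P0 \in Lfun P0 2%:E -> nef_domain P0 (2 * theta).
Proof.
move=> [dt QP Qt] /Lfun2_integrable_sqr /integrableP[_ L2].
have M0 := exp_moment0_gt0 dt.
have mt2 := measurable_funX 2 (measurable_tilt_density theta).
have ml2 := measurable_funX 2 (measurable_likelihood_ratio QP).
apply/nef_domainP.
have ti : P0.-integrable setT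
    (EFin \o (fun y : R => tilt_density theta y ^+ 2)).
  apply/integrableP; split.
    apply/measurable_EFinP.
    exact: mt2.
  apply: le_lt_trans L2; rewrite le_eqVlt; apply/orP; left; apply/eqP.
  apply: ae_eq_integral => //.
  - apply: measurableT_comp => //; apply/measurable_EFinP.
    exact: mt2.
  - apply: measurableT_comp => //; apply/measurable_EFinP.
    exact: ml2.
  - by apply: filterS Qt => y Qy _ /=; rewrite Qy.
have := integrableZl measurableT (M 0 theta ^+ 2) ti.
apply: eq_integrable => // y _ /=; congr EFin.
rewrite exprMn exprVn mulrC mulfVK ?expf_neq0 ?gt_eqF//.
by rewrite expr2 -expRD; congr expR; lra.
Qed.

(** A change of variables from [Q] to [P0].  It requires [y] to be integrable
    under [Q]; the nonnegative version of the change of variables, applied to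
    [`|y|], reduces this to the integrability of the first moment under
    [P0]. *)
Lemma is_tilt_mean theta Q : J theta -> is_tilt theta Q ->
  ('E_Q[idfun] = (tilted_mean P0 theta)%:E)%E.
Proof.
move=> Jt [dt QP Qt].
have M0 := exp_moment0_gt0 dt.
have i1 : P0.-integrable setT (EFin \o (fun y : R => y * tilt_density theta y)).
  have := integrableZl measurableT (M 0 theta)^-1 (integrable_moment 1 Jt).
  apply: eq_integrable => // y _ /=.
  by congr EFin; rewrite /tilt_density expr1; ring.
have mdQ := measurable_Radon_Nikodym QP.
have dQ : {ae P0, forall y : measurableTypeR R,
    Radon_Nikodym (charge_of_finite_measure Q) P0 y =
    (tilt_density theta y)%:E}.
  apply: filterS Qt => y <-.
  by rewrite /likelihood_ratio fineK// Radon_Nikodym_fin_num.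
have mid : measurable_fun [set: measurableTypeR R] (fun y : R => y%:E).
  exact/measurable_EFinP.
have Qi : Q.-integrable setT (fun y : R => y%:E).
  apply/integrableP; split => //.
  have mabs : measurable_fun [set: measurableTypeR R] (fun y : R => `|y%:E|%E).
    exact: measurableT_comp mid.
  rewrite -(Radon_Nikodym_SigmaFinite.change_of_variables QP)//.
  have /integrableP[_] := i1; apply: le_lt_trans.
  rewrite le_eqVlt; apply/orP; left; apply/eqP.
  apply: ae_eq_integral => //.
  - apply: emeasurable_funM => //.
    exact: measurable_int (Radon_Nikodym_SigmaFinite.f_integrable QP).
  - by apply: measurableT_comp => //; exact: measurable_int i1.
  - have := ae_eq_Radon_Nikodym_SigmaFinite QP measurableT.
    apply: filterS2 dQ => y dy /(_ I) fy _.
    rewrite fy dy -[LHS]EFinM.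
    by rewrite /= normrM (ger0_norm (tilt_density_ge0 y dt)).
rewrite unlock -(Radon_Nikodym_change_of_variables QP measurableT Qi).
transitivity (\int[P0]_y (y * tilt_density theta y)%:E)%E.
  apply: ae_eq_integral => //.
  - exact: emeasurable_funM.
  - exact: measurable_int i1.
  - by apply: filterS dQ => y dy _ /=; rewrite dy EFinM.
rewrite -[LHS]fineK; last exact: integrable_fin_num.
congr EFin; rewrite /tilted_mean mulrC.
rewrite -(RintegralZl _ measurableT (integrable_moment 1 Jt)).
by apply: eq_Rintegral => y _; rewrite /tilt_density expr1; ring.
Qed.

Lemma is_tilt_overlap theta1 theta2 (P : R -> probability (measurableTypeR R) R)
    x1 x2 : P 0 = P0 -> is_tilt theta1 (P x1) -> is_tilt theta2 (P x2) ->
  nef_domain P0 (theta1 + theta2) ->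
  channel_overlap P x1 x2 =
    M 0 (theta1 + theta2) * ((M 0 theta1)^-1 * (M 0 theta2)^-1) - 1.
Proof.
move=> P0E [d1 QP1 Q1] [d2 QP2 Q2] d12.
rewrite /channel_overlap P0E unlock.
pose f y := tilt_density theta1 y * tilt_density theta2 y
  - tilt_density theta1 y - (tilt_density theta2 y - 1).
transitivity (\int[P0]_y f y).
  congr fine; apply: ae_eq_integral => //.
  - apply/measurable_EFinP; apply: measurable_funM;
      apply: measurable_funB => //; exact: measurable_likelihood_ratio.
  - have m1 := measurable_tilt_density theta1.
    have m2 := measurable_tilt_density theta2.
    have mf := measurable_funB (measurable_funB (measurable_funM m1 m2) m1)
      (measurable_funB m2 (measurable_cst (1 : R))).
    by apply/measurable_EFinP; exact: mf.
  - apply: filterS2 Q1 Q2 => y -> -> _; congr EFin.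
    by rewrite /f mulrBl mulrBr mul1r mulr1.
have ti theta : nef_domain P0 theta ->
    P0.-integrable setT (EFin \o tilt_density theta) /\
    \int[P0]_y tilt_density theta y = 1.
  move=> dt; have M0 := exp_moment0_gt0 dt.
  move: (dt) => /nef_domainP it; split.
    exact: (integrableZr measurableT (M 0 theta)^-1 it).
  rewrite (RintegralZr _ measurableT it) -exp_moment0E.
  by rewrite divff ?gt_eqF.
have [i1 I1] := ti _ d1; have [i2 I2] := ti _ d2.
move: (d12) => /nef_domainP i12.
pose c := (M 0 theta1)^-1 * (M 0 theta2)^-1.
have prodE y : tilt_density theta1 y * tilt_density theta2 y =
    expR ((theta1 + theta2) * y) * c.
  by rewrite /tilt_density mulrACA -expRD mulrDl.
have ip : P0.-integrable setT
    (EFin \o (fun y : R => tilt_density theta1 y * tilt_density theta2 y)).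
  have := integrableZr measurableT c i12.
  by apply: eq_integrable => // y _ /=; rewrite prodE.
have ic : P0.-integrable setT (EFin \o (cst (1 : R))).
  exact: finite_measure_integrable_cst.
have Ic : \int[P0]_y (cst 1 y : R) = 1.
  rewrite [LHS](Rintegral_cst P0 measurableT) mul1r.
  exact: (congr1 fine (probability_setT P0)).
rewrite /f (RintegralB measurableT (integrableB measurableT ip i1)
  (integrableB measurableT i2 ic)).
rewrite (RintegralB measurableT ip i1) (RintegralB measurableT i2 ic).
rewrite I1 I2 Ic subrr subr0; congr (_ - _).
rewrite exp_moment0E -(RintegralZr _ measurableT i12).
by apply: eq_Rintegral => y _; rewrite prodE.
Qed.

End exponential_family.

(** * Parametrization by the mean *)

(** Here [D] is an open set of centered means and [t] assigns to each
    [x] in [D] the natural parameter of the member of mean [x + mu]. *)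
Section mean_parametrization.
Context {R : realType} (P0 : probability (measurableTypeR R) R).
Local Notation M := (exp_moment P0).
Local Notation J := (nef_domain P0)°.

Hypothesis nondegenerate :
  forall c, ~ {ae P0, forall y : measurableTypeR R, y = c}.
Variables (D : set R) (mu : R) (t : R -> R).
Hypothesis D_open : open D.
Hypothesis t_interior : forall x, D x -> J (t x).
Hypothesis t_mean : forall x, D x -> tilted_mean P0 (t x) = x + mu.

Let J_open : open J. Proof. exact: open_interior. Qed.

Lemma Ck_exp_moment n k : continuously_differentiable n J (M k).
Proof.
elim: n k => [|n ih] k.
  by move=> x /(is_derive_exp_moment k) /continuous_derive1.
exact: (CkS J_open (fun x => @is_derive_exp_moment _ P0 k x) (ih k.+1)).
Qed.

(** Any [theta] close to [t x] has its mean in [mu + D], hence equals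
    [t (m theta - mu)] by injectivity of the mean. *)
Lemma t_onto_near x : D x ->
  \forall theta \near t x, exists x', D x' /\ t x' = theta.
Proof.
move=> Dx; have Jx := t_interior Dx.
have ctm := continuous_derive1 (is_derive_tilted_mean Jx).
have ctmu : {for t x, continuous (fun theta => tilted_mean P0 theta - mu)}.
  by apply: cvgB; [exact: ctm|exact: cvg_cst].
have DD : nbhs (tilted_mean P0 (t x) - mu) D.
  by apply: open_nbhs_nbhs; split => //; rewrite t_mean// addrK.
have near_D : \forall theta \near t x, D (tilted_mean P0 theta - mu).
  exact: ctmu DD.
apply: filterS2 near_D (open_near J_open Jx) => theta Dtheta Jtheta.
exists (tilted_mean P0 theta - mu); split => //.
apply: (tilted_mean_inj nondegenerate (t_interior Dtheta) Jtheta).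
by rewrite t_mean// subrK.
Qed.

(** The inverse function theorem for [theta |-> m theta - mu], of which [t] is
    a left inverse near [t x]. *)
Lemma is_derive_t x : D x ->
  is_derive x 1 t (tilted_variance P0 (t x))^-1.
Proof.
move=> Dx; have Jx := t_interior Dx.
pose f theta := tilted_mean P0 theta - mu.
have ft z : D z -> f (t z) = z by move=> Dz; rewrite /f t_mean// addrK.
have df theta : J theta -> is_derive theta 1 f (tilted_variance P0 theta).
  move=> Jt; rewrite -[tilted_variance _ _]subr0.
  exact: is_deriveB (is_derive_tilted_mean Jt) (is_derive_cst mu theta 1).
rewrite -{1}(ft x Dx); apply: is_derive_inverse (df _ Jx) _.
- by apply: filterS (t_onto_near Dx) => theta [z [Dz <-]]; rewrite ft.
- apply: filterS (open_near J_open Jx) => theta /df dtheta.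
  exact: continuous_derive1 dtheta.
- by rewrite gt_eqF// tilted_variance_gt0.
Qed.

Lemma Ck_tilted_varianceV n :
  continuously_differentiable n J (fun theta => (tilted_variance P0 theta)^-1).
Proof.
apply: CkV => // [theta Jt|]; first by rewrite gt_eqF// tilted_variance_gt0.
have cM := Ck_exp_moment n.
apply: CkM => //.
  apply: CkD => //; first exact: CkM.
  apply: (Ck_ext J_open) (CkM J_open (Ck_cst n (-1) J_open)
    (CkM J_open (cM 1%N) (cM 1%N))).
  by move=> theta _; rewrite mulN1r.
apply: CkV => // [theta Jt|]; last exact: CkM.
by rewrite mulf_neq0// exp_moment0_neq0.
Qed.

Lemma Ck_comp_t n F : continuously_differentiable n J F ->
  continuously_differentiable n D (F \o t).
Proof.
exact: (Ck_comp_inverse D_open J_open t_interior is_derive_t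
  Ck_tilted_varianceV).
Qed.

Definition norm_const (x : R) : R := (M 0 (t x))^-1.

Definition param_overlap (x y : R) : R :=
  M 0 (t x + t y) * (norm_const x * norm_const y) - 1.

Lemma Ck_norm_const n : continuously_differentiable n D norm_const.
Proof.
apply: (@Ck_comp_t n (fun theta => (M 0 theta)^-1)).
by apply: CkV => // [theta|]; [exact: exp_moment0_neq0|exact: Ck_exp_moment].
Qed.

Hypothesis t_domain : forall x, D x -> nef_domain P0 (2 * t x).

(** The parameters near [t x] are values of [t], so the points near [2 * t x]
    are doubles of values of [t]. *)
Lemma interior_t_double x : D x -> J (2 * t x).
Proof.
move=> /t_onto_near /nbhs_ballP[e /= e0 eD].
apply/nbhs_ballP; exists e => //= s; rewrite /ball /= => se.
have [|z [Dz tz]] := eD (s / 2); last first.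
  by have := t_domain Dz; rewrite tz mulrCA divff ?mulr1.
rewrite /ball /= (_ : _ - _ = (2 * t x - s) / 2); last by field.
rewrite normrM (ger0_norm (_ : 0 <= 2^-1))//; lra.
Qed.

(** The sum lies between [2 * t x] and [2 * t y]. *)
Lemma interior_t_add x y : D x -> D y -> J (t x + t y).
Proof.
move=> /interior_t_double Jx /interior_t_double Jy.
case: (leP (t x) (t y)) => h.
  by apply: (interior_nef_domain_between _ _ Jx Jy); lra.
by apply: (interior_nef_domain_between _ _ Jy Jx); lra.
Qed.

Lemma Ck2_param_overlap n :
  continuously_differentiable2 n (D `*` D) param_overlap.
Proof.
have oDD := open_setX D_open D_open.
apply: (Ck2D oDD); last exact: Ck2_cst.
apply: (@Ck2_sum_variable _ n 0 M J D t
  (fun x => (tilted_variance P0 (t x))^-1)) => //.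
- exact: interior_t_add.
- exact: is_derive_exp_moment.
- exact: is_derive_t.
- by move=> k; exact: (Ck_comp_t (Ck_tilted_varianceV k)).
- exact: Ck_norm_const.
- exact: Ck_norm_const.
Qed.

Hypothesis D0 : D 0.
Hypothesis J0 : J 0.
Hypothesis P0_mean : tilted_mean P0 0 = mu.

Lemma t_at0 : t 0 = 0.
Proof.
apply: (tilted_mean_inj nondegenerate (t_interior D0) J0).
by rewrite t_mean// add0r.
Qed.

(** The derivative at [0] is [t'(0) * (M 1 (t x) - mu * M 0 (t x)) / M 0 (t x)],
    where the term with [mu] comes from the normalizing factor; the quotient is
    the mean of the member of parameter [t x], minus [mu]. *)
Lemma partial2_param_overlap x : D x ->
  partial2 param_overlap x 0 = (tilted_variance P0 0)^-1 * x.
Proof.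
move=> Dx; apply: derive1_is_derive1.
have dt0 := is_derive_t D0; rewrite t_at0 in dt0.
set w := (tilted_variance P0 0)^-1 in dt0 *.
have dtt : is_derive (0 : R) 1 (fun y => t x + t y) (0 + w).
  exact: is_deriveD (is_derive_cst (t x) (0 : R) 1) dt0.
have Jx : J (t x + t 0) by exact: interior_t_add.
have dM := @is_derive1_comp _ (M 0) (fun y => t x + t y) 0 _ _
  (is_derive_exp_moment 0 Jx) dtt.
have M00 : M 0 (t 0) != 0 by rewrite t_at0 exp_moment0_at0 oner_neq0.
have Jt0 : J (t 0) by rewrite t_at0.
have dMt := @is_derive1_comp _ (M 0) t 0 _ _ (is_derive_exp_moment 0 Jt0) dt0.
have dn := @is_deriveV _ (M 0 \o t) 0 _ _ M00 dMt.
have dg := is_derive1M (is_derive_cst (norm_const x) (0 : R) 1) dn.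
have := is_deriveB (is_derive1M dM dg) (is_derive_cst (1 : R) (0 : R) 1).
move=> dR; apply: is_derive_eq dR _.
rewrite /= t_at0 exp_moment0_at0 !addr0 /GRing.scale /=.
have mu1 : M 1 0 = mu by rewrite -P0_mean /tilted_mean exp_moment0_at0 divr1.
have mx := t_mean Dx; have M0x := exp_moment0_neq0 (t_interior Dx).
have {mx} M1x : M 1 (t x) = (x + mu) * M 0 (t x).
  by rewrite -mx /tilted_mean divfK.
rewrite mu1 M1x /norm_const; move: M0x; move: (M 0 (t x)) => a a0.
by field.
Qed.

End mean_parametrization.

(** * The overlap of the channel *)

Section base_moments.
Context {R : realType} (P0 : probability (measurableTypeR R) R).
Local Notation M := (exp_moment P0).

(** A random variable almost surely equal to [c] has mean [c] and therefore
    variance zero. *)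
Lemma nondegenerate_of_variance (v : R) : 0 < v -> ('V_P0[idfun] = v%:E)%E ->
  forall c, ~ {ae P0, forall y : measurableTypeR R, y = c}.
Proof.
move=> v0 Vv c yc.
have mid : measurable_fun [set: measurableTypeR R] (fun y : R => y%:E).
  exact/measurable_EFinP.
have Ec : ('E_P0[idfun] = c%:E)%E.
  rewrite unlock; transitivity (\int[P0]_y (cst c%:E y))%E.
    apply: ae_eq_integral => //; apply: filterS yc => y -> _ //.
  by rewrite integral_cst// [X in (_ * X)%E]probability_setT mule1.
move: Vv; rewrite /variance unlock Ec unlock.
have -> : (\int[P0]_w
    (((idfun \- cst (fine c%:E)) * (idfun \- cst (fine c%:E)))%R w)%:E
    = \int[P0]_y (cst 0 y))%E.
  apply: ae_eq_integral => //.
    have mB : measurable_fun [set: measurableTypeR R] (fun y : R => y - c).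
      by apply: measurable_funB.
    apply/measurable_EFinP; exact: (measurable_funM mB mB).
  by apply: filterS yc => y -> _; rewrite /= /GRing.mul /= subrr mul0r.
by rewrite integral0 => -[v00]; move: v0; rewrite -v00 ltxx.
Qed.

Hypothesis J0 : (nef_domain P0)° 0.

Lemma tilted_mean0 (mu : R) : ('E_P0[idfun] = mu%:E)%E -> tilted_mean P0 0 = mu.
Proof.
rewrite unlock => Emu; rewrite /tilted_mean exp_moment0_at0 divr1 /exp_moment.
transitivity (\int[P0]_y y).
  by apply: eq_Rintegral => y _; rewrite expr1 mul0r expR0 mulr1.
by rewrite /Rintegral [X in fine X]Emu.
Qed.

Lemma tilted_variance0 (mu v : R) : ('E_P0[idfun] = mu%:E)%E ->
  ('V_P0[idfun] = v%:E)%E -> tilted_variance P0 0 = v.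
Proof.
move=> Emu Vv; have := tilted_mean0 Emu.
have := centered_moment2E mu J0.
rewrite /tilted_mean /tilted_variance exp_moment0_at0 divr1 => + M1.
rewrite M1 !mulr1 invr1 mulr1 => M2.
have -> : M 2 0 - mu * mu = M 2 0 - 2 * mu * mu + mu ^+ 2 by ring.
rewrite M2; move: Vv; rewrite /variance unlock Emu unlock => Vv.
transitivity (fine v%:E) => //; rewrite -Vv; congr fine.
by apply: eq_integral => y _; rewrite mul0r expR0 mulr1.
Qed.

End base_moments.

Theorem proposition3p12 (R : realType) (A mu sigma : R)
  (Sigma U U' : set R)
  (P : R -> probability (measurableTypeR R) R)
  (A_gt0 : 0 < A)
  (Sigma0 : Sigma 0)
  (P_good : good_channel Sigma P)
  (P0_mean : ('E_(P 0%R)[idfun] = mu%:E)%E)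
  (P0_variance : 'V_(P 0)[idfun] = (sigma ^+ 2)%:E)
  (sigma2_gt0 : 0 < sigma ^+ 2)
  (P_nef : forall x, Sigma x ->
     in_nef (P 0) (P x) /\ (x%:E = 'E_(P x)[idfun] - mu%:E)%E)
  (U_open : open U) (U0 : U 0)
  (U_dom : U `<=` nef_domain (P 0))
  (psi_C5 : continuously_differentiable 5 U (fine \o cumulant (P 0)))
  (U'_open : open U')
  (U'_sup : `[- A + mu, A + mu]%classic `<=` U')
  (U'_sub : U' `<=` derive1 (fine \o cumulant (P 0)) @` U)
  (Sigma_sup : [set u - mu | u in U'] `<=` Sigma) :
  [/\ exists W : set (R * R),
        [/\ open W, `[- A, A]%classic `*` `[- A, A]%classic `<=` W,
            W `<=` Sigma `*` Sigma &
            continuously_differentiable2 4 W (channel_overlap P)],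
      partial1 (partial1 (partial2 (channel_overlap P))) 0 0 = 0 &
      fisher_information P = 1 / sigma ^+ 2].
Proof.
pose D := [set x | U' (x + mu)].
have D_open : open D.
  apply: open_comp U'_open => x _.
  by apply: cvgD; [exact: cvg_id|exact: cvg_cst].
have ballD x : `[- A, A]%classic x -> D x.
  rewrite /= in_itv/= => /andP[? ?]; apply: U'_sup.
  by rewrite /= in_itv/= !lerD2r; apply/andP.
have D0 : D 0 by apply: ballD; rewrite /= in_itv/= oppr_le0 !ltW.
have DSigma x : D x -> Sigma x.
  by move=> Dx; apply: Sigma_sup; exists (x + mu) => //; rewrite addrK.
have J0 : (nef_domain (P 0))° 0.
  by apply: filterS (open_near U_open U0) => theta /U_dom.
have nondeg := nondegenerate_of_variance sigma2_gt0 P0_variance.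
have mean0 := tilted_mean0 P0_mean.
have var0 := tilted_variance0 J0 P0_mean P0_variance.
(* Membership of [P x] in the family supplies the parameter, square
   integrability makes it interior, and the mean then identifies it. *)
have /choice[t tP] : forall x, exists theta, D x ->
    [/\ is_tilt (P 0) theta (P x), nef_domain (P 0) (2 * theta),
        (nef_domain (P 0))° theta & tilted_mean (P 0) theta = x + mu].
  move=> x; case: (pselect (D x)) => [Dx|nDx]; last by exists 0.
  have [/in_nef_is_tilt[theta Px] xE] := P_nef x (DSigma x Dx).
  have d2 := is_tilt_L2 Px (P_good x (DSigma x Dx)).2.
  have Jt := interior_nef_domain_half J0 d2.
  exists theta => _; split=> //.
  by move: xE; rewrite (is_tilt_mean Jt Px) => -[->]; rewrite subrK.
have t_interior x : D x -> (nef_domain (P 0))° (t x) by case/tP.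
have t_mean x : D x -> tilted_mean (P 0) (t x) = x + mu by case/tP.
have t_domain x : D x -> nef_domain (P 0) (2 * t x) by case/tP.
have overlapE x y : D x -> D y ->
    param_overlap (P 0) t x y = channel_overlap P x y.
  move=> Dx Dy; have [Px _ _ _] := tP _ Dx; have [Py _ _ _] := tP _ Dy.
  rewrite (is_tilt_overlap erefl Px Py) //; apply: interior_nef_domain.
  exact: (interior_t_add nondeg D_open t_interior t_mean t_domain).
have DD_open := open_setX D_open D_open.
have partial2E x : D x ->
    partial2 (channel_overlap P) x 0 = (sigma ^+ 2)^-1 * x.
  move=> Dx; rewrite -var0.
  rewrite -(partial2_param_overlap nondeg D_open t_interior t_mean t_domain
    D0 J0 mean0 Dx).
  rewrite /partial2 !derive1E; apply: near_eq_derive.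
  by apply: filterS (open_near D_open D0) => y Dy; rewrite overlapE.
have partial12E x : D x ->
    partial1 (partial2 (channel_overlap P)) x 0 = (sigma ^+ 2)^-1.
  move=> Dx; apply: derive1_is_derive1.
  have lin : is_derive x 1 (fun z : R => (sigma ^+ 2)^-1 * z) (sigma ^+ 2)^-1.
    have dl := is_derive1M (is_derive_cst (sigma ^+ 2)^-1 x 1)
      (is_derive_id x 1).
    apply: is_derive_eq dl _.
    by rewrite mul0r add0r mulr1.
  apply: near_eq_is_derive lin.
  by apply: filterS (open_near D_open Dx) => z Dz; rewrite partial2E.
split.
- exists (D `*` D); split => //.
  + by move=> [x y] [/= xA yA]; split; exact: ballD.
  + by move=> [x y] [/= Dx Dy]; split; exact: DSigma.
  + apply: Ck2_ext DD_open _ (Ck2_param_overlap nondeg D_open t_interior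
      t_mean t_domain 4).
    by move=> [x y] [/= Dx Dy]; exact: overlapE.
- apply: derive1_is_derive1.
  apply: near_eq_is_derive (is_derive_cst (sigma ^+ 2)^-1 (0 : R) 1).
  by apply: filterS (open_near D_open D0) => z Dz; rewrite partial12E.
- by rewrite /fisher_information partial12E// div1r.
Qed.
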